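(* Let $\epsilon\in\{0,\frac12\}$. Every local automorphism of $\mathrm{SVir}[\epsilon]$ is an automorphism of $\mathrm{SVir}[\epsilon]$.
   Context: For $\epsilon\in\{0,\frac12\}$, the super Virasoro algebra $\mathrm{SVir}[\epsilon]$ is the Lie superalgebra over $\mathbb{C}$ with basis $\{L_m, G_r, C : m\in\mathbb{Z}, r\in\mathbb{Z}+\epsilon\}$, even part spanned by the $L_m$ and $C$, odd part spanned by the $G_r$, and brackets $[L_m,L_n]=(m-n)L_{m+n}+\frac{1}{12}\delta_{m+n,0}(m^3-m)C$, $[L_m,G_r]=(\frac m2-r)G_{m+r}$, $[G_r,G_s]=2L_{r+s}+\frac13\delta_{r+s,0}(r^2-\frac14)C$, with $C$ central. An automorphism is an even bijective linear map preserving the bracket. A linear map $\phi:L\to L$ is a local automorphism if for every $x\in L$ there is an automorphism $\theta_x$ of $L$ with $\phi(x)=\theta_x(x)$. *)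

(* Defs.v *)
From HB Require Import structures.
From mathcomp Require Import all_boot all_algebra.
From mathcomp Require Import complex.
From mathcomp Require Import Rstruct.
From mathcomp Require Import monalg.

Set Implicit Arguments.
Unset Strict Implicit.
Unset Printing Implicit Defensive.

Import GRing.Theory Num.Theory.
Local Open Scope ring_scope.

Definition CC : numClosedFieldType := (Rdefinitions.R)[i].

(* Basis of SVir[eps]:
   BL m  = L_m          (m : int),
   BG k  = G_(k + eps)  (k : int), so r = k + eps ranges over Z + eps,
   BC    = C (central). *)
Inductive SVB := BL of int | BG of int | BC.

Definition SVB_enc (b : SVB) : int + int + unit :=
  match b with BL m => inl (inl m) | BG k => inl (inr k) | BC => inr tt end.
Definition SVB_dec (c : int + int + unit) : SVB :=
  match c with inl (inl m) => BL m | inl (inr k) => BG k | inr _ => BC end.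
Lemma SVB_encK : cancel SVB_enc SVB_dec. Proof. by case. Qed.
HB.instance Definition _ := Choice.copy SVB (can_type SVB_encK).

Notation SV := {malg CC[SVB]}.

(* The parameter eps in {0, 1/2} is encoded by a boolean [ns]:
   ns = false <-> eps = 0,  ns = true <-> eps = 1/2. *)
Definition epsC (ns : bool) : CC := if ns then 2%:R^-1 else 0.
Definition epsZ (ns : bool) : int := if ns then 1 else 0.  (* = 2 eps *)

Definition gidx (ns : bool) (k : int) : CC := k%:~R + epsC ns.

(* Bracket on basis vectors. Note G_r, G_s give L_(r+s) with
   r + s = (k + l) + 2 eps. *)
Definition br_basis (ns : bool) (a b : SVB) : SV :=
  match a, b with
  | BL m, BL n =>
      (m - n)%:~R *: << BL (m + n) >>
      + ((m + n == 0)%:R * ((m ^+ 3 - m)%:~R / 12%:R)) *: << BC >>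
  | BL m, BG k =>
      (m%:~R / 2%:R - gidx ns k) *: << BG (m + k) >>
  | BG k, BL m =>
      - ((m%:~R / 2%:R - gidx ns k) *: << BG (m + k) >>)
  | BG k, BG l =>
      2%:R *: << BL (k + l + epsZ ns) >>
      + ((k + l + epsZ ns == 0)%:R
           * ((gidx ns k ^+ 2 - 4%:R^-1) / 3%:R)) *: << BC >>
  | _, _ => 0
  end.

Definition svbracket (ns : bool) (x y : SV) : SV :=
  \sum_(a <- finmap.enum_fset (msupp x)) \sum_(b <- finmap.enum_fset (msupp y)) (x@_a * y@_b) *: br_basis ns a b.

Definition odd_basis (b : SVB) : bool := if b is BG _ then true else false.
Definition even_elt (x : SV) : Prop := forall b, odd_basis b -> x@_b = 0.
Definition odd_elt (x : SV) : Prop := forall b, ~~ odd_basis b -> x@_b = 0.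
Definition even_map (f : SV -> SV) : Prop :=
  forall x, (even_elt x -> even_elt (f x)) /\ (odd_elt x -> odd_elt (f x)).

Definition is_linear_map (f : SV -> SV) : Prop :=
  forall (a : CC) (x y : SV), f (a *: x + y) = a *: f x + f y.

Definition is_automorphism (ns : bool) (f : SV -> SV) : Prop :=
  [/\ is_linear_map f, bijective f, even_map f
    & forall x y, f (svbracket ns x y) = svbracket ns (f x) (f y)].

Definition is_local_automorphism (ns : bool) (phi : SV -> SV) : Prop :=
  is_linear_map phi /\
  forall x : SV, exists theta : SV -> SV, is_automorphism ns theta /\ phi x = theta x.

(* Main.v *)
Require Import Defs.
From mathcomp Require Import all_boot all_order all_algebra.
From mathcomp Require Import finmap monalg ring zify.

Set Implicit Arguments.
Unset Strict Implicit.
Unset Printing Implicit Defensive.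

Import Order.TTheory GRing.Theory Num.Theory.
Local Open Scope ring_scope.

(* Every automorphism is one of the explicit maps
     L_m |-> e a^m L_(e m),  G_r |-> c a^k G_(e r) (r = k + eps),  C |-> e C
   with e = 1 or -1, a <> 0 and c^2 = e a^(2 eps).  Indeed ad L_0 is diagonalizable, hence
   so is ad (theta L_0); looking at top and bottom terms of eigenvectors this forces
   theta L_0 into the span of L_0 and C, comparing spectra gives the sign e, theta permutes
   the weight spaces accordingly, and the brackets determine the scalars.
   A local automorphism phi is read off from its values on L_0 + b and
   L_0 + L_1 + G_0 + b, for b a basis vector: the terms L_0, L_1, G_0 pin down e, a, c
   independently of b. *)

Section SuperVirasoro.

Context (F : numClosedFieldType) (ns : bool).

Local Notation S := {malg F[SVB]}.
Local Notation "''v_' b" := (<< b >> : S) (at level 8, b at level 2).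

(* The definitions of [Defs] over an arbitrary [F]: at [F := CC] they are convertible to the
   originals, while the instances of an abstract field, unlike those of [CC], cannot be
   unfolded by unification. *)
Definition idx (k : int) : F := k%:~R + (if ns then 2%:R^-1 else 0).

Definition br (a b : SVB) : S :=
  match a, b with
  | BL m, BL n =>
      (m - n)%:~R *: << BL (m + n) >>
      + ((m + n == 0)%:R * ((m ^+ 3 - m)%:~R / 12%:R)) *: << BC >>
  | BL m, BG k =>
      (m%:~R / 2%:R - idx k) *: << BG (m + k) >>
  | BG k, BL m =>
      - ((m%:~R / 2%:R - idx k) *: << BG (m + k) >>)
  | BG k, BG l =>
      2%:R *: << BL (k + l + epsZ ns) >>
      + ((k + l + epsZ ns == 0)%:R
           * ((idx k ^+ 2 - 4%:R^-1) / 3%:R)) *: << BC >>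
  | _, _ => 0
  end.

Definition bracket (x y : S) : S :=
  \sum_(a <- finmap.enum_fset (msupp x)) \sum_(b <- finmap.enum_fset (msupp y))
    (x@_a * y@_b) *: br a b.

Definition evenF (x : S) : Prop := forall b, odd_basis b -> x@_b = 0.
Definition oddF (x : S) : Prop := forall b, ~~ odd_basis b -> x@_b = 0.

Definition autF (f : S -> S) : Prop :=
  [/\ linear f, bijective f,
      forall x, (evenF x -> evenF (f x)) /\ (oddF x -> oddF (f x))
    & forall x y, f (bracket x y) = bracket (f x) (f y)].

(** * Linear extension from the basis and bilinearity of the bracket *)

Definition linext (f : SVB -> S) (x : S) : S :=
  \sum_(b <- finmap.enum_fset (msupp x)) x@_b *: f b.

Lemma linextEw (f : SVB -> S) (x : S) (A : {fset SVB}) :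
  (msupp x `<=` A)%fset ->
  linext f x = \sum_(b <- finmap.enum_fset A) x@_b *: f b.
Proof.
move=> sxA; apply: big_fset_incl => // b _ nxb.
by rewrite mcoeff_outdom // scale0r.
Qed.

Lemma linext_is_linear (f : SVB -> S) : linear (linext f).
Proof.
move=> c x y; set A := (msupp x `|` msupp y `|` msupp (c *: x + y))%fset.
have sx : (msupp x `<=` A)%fset by rewrite /A -fsetUA fsubsetUl.
have sy : (msupp y `<=` A)%fset.
  by rewrite /A fsetUAC fsubsetUr.
have sz : (msupp (c *: x + y) `<=` A)%fset by rewrite fsubsetUr.
rewrite (linextEw f sx) (linextEw f sy) (linextEw f sz) scaler_sumr -big_split /=.
by apply: eq_bigr => b _; rewrite mcoeffD mcoeffZ scalerDl scalerA.
Qed.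

Lemma linext_basis (f : SVB -> S) b : linext f 'v_b = f b.
Proof. by rewrite /linext msuppU oner_eq0 big_seq_fset1 mcoeffUU scale1r. Qed.

Lemma mcoeff_basis b k : 'v_b@_k = (b == k)%:R.
Proof. by rewrite mcoeffU. Qed.

Section Linear.

Context (f : S -> S) (lin_f : linear f).

Lemma lin0 : f 0 = 0.
Proof. by have := lin_f (-1) 0 0; rewrite scaler0 addr0 scaleN1r addNr. Qed.

Lemma linD x y : f (x + y) = f x + f y.
Proof. by have := lin_f 1 x y; rewrite !scale1r. Qed.

Lemma linZ c x : f (c *: x) = c *: f x.
Proof. by have := lin_f c x 0; rewrite lin0 !addr0. Qed.

Lemma linN x : f (- x) = - f x.
Proof. by rewrite -scaleN1r linZ scaleN1r. Qed.

Lemma lin_sum I (r : seq I) (h : I -> S) :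
  f (\sum_(i <- r) h i) = \sum_(i <- r) f (h i).
Proof. by apply: big_morph => [x y|]; [apply: linD | apply: lin0]. Qed.

Lemma linE x : f x = \sum_(b <- finmap.enum_fset (msupp x)) x@_b *: f 'v_b.
Proof.
rewrite {1}[x]monalgE lin_sum; apply: eq_bigr => b _; rewrite -linZ; congr f.
by apply/malgP => k; rewrite mcoeffZ !mcoeffU mulr_natr.
Qed.

End Linear.

Lemma eq_lin_basis (f g : S -> S) : linear f -> linear g ->
  (forall b, f 'v_b = g 'v_b) -> f =1 g.
Proof.
by move=> lf lg efg x; rewrite (linE lf) (linE lg); apply: eq_bigr => b _; rewrite efg.
Qed.

Lemma lin_comp (f g : S -> S) : linear f -> linear g -> linear (f \o g).
Proof. by move=> lf lg c x y; rewrite /= lg lf. Qed.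

Lemma lin_id : linear (@id S).
Proof. by []. Qed.

Lemma bracketEl x y : bracket x y = linext (fun a => linext (br a) y) x.
Proof.
apply: eq_bigr => a _; rewrite /linext scaler_sumr.
by apply: eq_bigr => b _; rewrite scalerA.
Qed.

Lemma bracketEr x y : bracket x y = linext (fun b => linext (br ^~ b) x) y.
Proof.
rewrite /bracket exchange_big /=; apply: eq_bigr => b _; rewrite /linext scaler_sumr.
by apply: eq_bigr => a _; rewrite scalerA mulrC.
Qed.

Lemma bracket_linr x : linear (bracket x).
Proof. by move=> c y z; rewrite !bracketEr linext_is_linear. Qed.

Lemma bracket_linl y : linear (bracket ^~ y).
Proof. by move=> c x z; rewrite !bracketEl linext_is_linear. Qed.

Lemma bracketDl x y z : bracket (x + y) z = bracket x z + bracket y z.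
Proof. exact: (linD (bracket_linl z)). Qed.

Lemma bracketZl c x y : bracket (c *: x) y = c *: bracket x y.
Proof. exact: (linZ (bracket_linl y)). Qed.

Lemma bracketZZ c d x y :
  bracket (c *: x) (d *: y) = (c * d) *: bracket x y.
Proof.
by rewrite (linZ (bracket_linr _)) bracketZl scalerA mulrC.
Qed.

Lemma bracket_basis a b : bracket 'v_a 'v_b = br a b.
Proof. by rewrite bracketEl !linext_basis. Qed.

Lemma mcoeff_bracket x y k :
  (bracket x y)@_k =
  \sum_(a <- finmap.enum_fset (msupp x)) \sum_(b <- finmap.enum_fset (msupp y))
     x@_a * y@_b * (br a b)@_k.
Proof.
rewrite /bracket raddf_sum; apply: eq_bigr => a _; rewrite raddf_sum.
by apply: eq_bigr => b _; rewrite /= mcoeffZ.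
Qed.

Lemma eq_comb2 c1 c2 d1 d2 (x y : S) : c1 = d1 -> c2 = d2 ->
  c1 *: x + c2 *: y = d1 *: x + d2 *: y.
Proof. by move=> -> ->. Qed.

Lemma mcoeff_comb2 c1 c2 (x y : S) b : (c1 *: x + c2 *: y)@_b = c1 * x@_b + c2 * y@_b.
Proof. by rewrite mcoeffD !mcoeffZ. Qed.

(** * The explicit automorphisms *)

(* [flip true] sends L_m to L_(-m) and G_r to G_(-r): for r = k + eps, -r has index -k - 2 eps. *)
Definition flip (s : bool) (b : SVB) : SVB :=
  match b with
  | BL m => BL (if s then - m else m)
  | BG k => BG (if s then - k - epsZ ns else k)
  | BC => BC
  end.

Lemma flipK s : involutive (flip s).
Proof. by case: s => -[m|k|] //=; congr (_ _); lia. Qed.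

Lemma odd_flip s b : odd_basis (flip s b) = odd_basis b.
Proof. by case: b. Qed.

(** The exponent at [BG k] is the integer [k], not [r = k + eps]: a possible half power of [a] is
    absorbed in [c]. *)
Definition svweight (s : bool) (a c : F) (b : SVB) : F :=
  match b with
  | BL m => (-1) ^+ s * a ^ m
  | BG k => c * a ^ k
  | BC => (-1) ^+ s
  end.

Lemma svweight_neq0 s a c b : a != 0 -> c != 0 -> svweight s a c b != 0.
Proof.
move=> a0 c0; case: b => [m|k|] /=; rewrite ?mulf_neq0 ?expfz_neq0 ?signr_eq0 //.
Qed.

Definition svaut (s : bool) (a c : F) : S -> S :=
  linext (fun b => svweight s a c b *: 'v_(flip s b)).

Lemma svaut_lin s a c : linear (svaut s a c).
Proof. exact: linext_is_linear. Qed.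

Lemma svaut_basis s a c b : svaut s a c 'v_b = svweight s a c b *: 'v_(flip s b).
Proof. exact: linext_basis. Qed.

Lemma mcoeff_monomial f s (w : SVB -> F) : linear f ->
  (forall b, f 'v_b = w b *: 'v_(flip s b)) ->
  forall x b, (f x)@_(flip s b) = w b * x@_b.
Proof.
move=> lf fb x b; rewrite [X in _ * X@__](linE lin_id) (linE lf) !raddf_sum mulr_sumr.
apply: eq_bigr => d _; rewrite /= fb !mcoeffZ !mcoeff_basis.
rewrite (inj_eq (can_inj (flipK s))).
by case: eqP => [->|_]; rewrite ?mulr1 ?mulr0 // mulrC.
Qed.

Lemma mcoeff_svaut s a c x b :
  (svaut s a c x)@_(flip s b) = svweight s a c b * x@_b.
Proof. exact: (mcoeff_monomial (@svaut_lin s a c) (@svaut_basis s a c)). Qed.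

Lemma svaut_bij s a c : a != 0 -> c != 0 -> bijective (svaut s a c).
Proof.
move=> a0 c0; have w0 b := svweight_neq0 s b a0 c0.
pose g := linext (fun b => (svweight s a c (flip s b))^-1 *: 'v_(flip s b)).
have lg : linear g by exact: linext_is_linear.
have lf := @svaut_lin s a c.
exists g => x.
  apply: (eq_lin_basis (lin_comp lg lf) lin_id) => d /=.
  by rewrite svaut_basis (linZ lg) /g linext_basis flipK scalerA mulfV ?scale1r.
apply: (eq_lin_basis (lin_comp lf lg) lin_id) => d /=.
by rewrite /g linext_basis (linZ lf) svaut_basis flipK scalerA mulVf ?scale1r.
Qed.

(** Negating all indices negates the structure constants of [L, L] and [L, G], which the sign in the
    weights of [BL] and [BC] compensates. Those of [G, G] are even in the indices, so there the sign
    must come from [c ^+ 2]. *)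
Lemma svaut_br (s : bool) (a c : F) d e : a != 0 -> c ^+ 2 = (-1) ^+ s * a ^ epsZ ns ->
  svaut s a c (br d e) =
  (svweight s a c d * svweight s a c e) *: br (flip s d) (flip s e).
Proof.
move=> a0 c2.
have lf := @svaut_lin s a c.
have c2e k l : c * a ^ k * (c * a ^ l) = (-1) ^+ s * a ^ (k + l + epsZ ns).
  by rewrite !expfzDr // mulrACA -expr2 c2; ring.
have sLL m n : (-1) ^+ s * a ^ m * ((-1) ^+ s * a ^ n) = a ^ (m + n).
  by rewrite mulrACA -expr2 sqrr_sign mul1r expfzDr.
have sLG m k : (-1) ^+ s * a ^ m * (c * a ^ k) = (-1) ^+ s * (c * a ^ (m + k)).
  by rewrite expfzDr //; ring.
have wG k : idx (if s then - k - epsZ ns else k) = (-1) ^+ s * idx k.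
  rewrite /idx /epsZ; case: s {c2 c2e sLL sLG lf}; last by rewrite expr0 mul1r.
  by case: ns; rewrite ?rmorphB ?rmorphN /= expr1; field.
have wLG m k : (if s then - m else m)%:~R / 2 -
    idx (if s then - k - epsZ ns else k) =
    (-1) ^+ s * (m%:~R / 2 - idx k) :> F.
  rewrite wG; case: (s); last by rewrite expr0 !mul1r.
  by rewrite rmorphN /= expr1; ring.
have iLG (m k : int) : (if s then - m else m) + (if s then - k - epsZ ns else k) =
    (if s then - (m + k) - epsZ ns else m + k).
  by case: (s); lia.
have iLL (m n : int) : (if s then - m else m) + (if s then - n else n) =
             (if s then - (m + n) else m + n).
  by case: (s); lia.
have i0 (m : int) : ((if s then - m else m) == 0) = (m == 0).
  by case: (s) => //; rewrite oppr_eq0.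
case: d e => [m|k|] [n|l|] /=; rewrite ?(lin0 lf) ?scaler0 //.
- rewrite (linD lf) !(linZ lf) !svaut_basis /= scalerDr !scalerA sLL iLL i0.
  apply: eq_comb2.
    by case: (s); rewrite ?expr0 ?expr1 ?rmorphB ?rmorphN /=; ring.
  case: eqP => [->|_]; last by rewrite !mul0r mulr0.
  rewrite expr0z; case: (s); rewrite ?expr0 ?expr1.
    by rewrite !rmorphB ?rmorphXn rmorphN /=; ring.
  by ring.
- rewrite (linZ lf) svaut_basis /= !scalerA sLG iLG wLG; congr (_ *: _).
  by rewrite mulrACA -expr2 sqrr_sign mul1r mulrC.
- rewrite (linN lf) (linZ lf) svaut_basis /= scalerN !scalerA iLG wLG.
  rewrite [c * _ * _]mulrC sLG; congr (- (_ *: _)).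
  by rewrite mulrACA -expr2 sqrr_sign mul1r mulrC.
- have iGG : (if s then - k - epsZ ns else k) + (if s then - l - epsZ ns else l)
      + epsZ ns = (if s then - (k + l + epsZ ns) else k + l + epsZ ns).
    by case: (s); lia.
  rewrite (linD lf) !(linZ lf) !svaut_basis /= scalerDr !scalerA c2e iGG i0.
  apply: eq_comb2; first by rewrite mulrC.
  case: eqP => [->|_]; last by rewrite !mul0r mulr0.
  by rewrite expr0z wG exprMn sqrr_sign; ring.
Qed.

Lemma autF_svaut (s : bool) (a c : F) : a != 0 -> c ^+ 2 = (-1) ^+ s * a ^ epsZ ns ->
  autF (svaut s a c).
Proof.
move=> a0 c2; have lf := @svaut_lin s a c.
have c0 : c != 0.
  by rewrite -sqrf_eq0 c2 mulf_neq0 ?signr_eq0 ?expfz_neq0.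
split=> //; first exact: svaut_bij.
  by move=> x; split=> px b ob; rewrite -(flipK s b) mcoeff_svaut px ?odd_flip ?mulr0.
move=> x y.
apply: (@eq_lin_basis (svaut s a c \o (bracket ^~ y))
                      ((bracket ^~ (svaut s a c y)) \o svaut s a c)).
- exact: lin_comp lf (bracket_linl _).
- exact: lin_comp (bracket_linl _) lf.
move=> d /=; apply: (@eq_lin_basis (svaut s a c \o bracket 'v_d)
                                   (bracket (svaut s a c 'v_d) \o svaut s a c)).
- exact: lin_comp lf (bracket_linr _).
- exact: lin_comp (bracket_linr _) lf.
by move=> e /=; rewrite !svaut_basis bracketZZ !bracket_basis svaut_br.
Qed.

(** * Weights for ad L_0 *)

Definition wt (b : SVB) : F :=
  match b with BL m => m%:~R | BG k => idx k | BC => 0 end.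

Lemma wt_flip s b : wt (flip s b) = (-1) ^+ s * wt b.
Proof.
case: s; last by rewrite expr0 mul1r; case: b.
rewrite expr1 mulN1r; case: b => [m|k|] /=; rewrite ?oppr0 ?rmorphN //.
by rewrite /idx /epsZ; case: ns; rewrite ?rmorphB ?rmorphN /=; field.
Qed.

(** Within a parity, the only coincidence of weights is between [BL 0] and [BC], both of weight
    zero; the last hypothesis excludes it. *)
Lemma wt_inj b b' : odd_basis b = odd_basis b' -> wt b = wt b' ->
  odd_basis b || (wt b != 0) -> b = b'.
Proof.
case: b b' => [m|k|] [n|l|] //=; rewrite ?eqxx // => _.
- by move=> /intr_inj ->.
- by move=> ->; rewrite eqxx.
- by move=> /addIr /intr_inj ->.
Qed.

Lemma br_L0 b : br (BL 0) b = (- wt b) *: 'v_b.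
Proof.
case: b => [m|k|] /=; last by rewrite oppr0 scale0r.
  rewrite sub0r add0r rmorphN /= expr0n /= sub0r.
  by rewrite oppr0 mul0r mulr0 scale0r addr0.
by rewrite mul0r sub0r add0r.
Qed.

Lemma mcoeff_bracket_L0C u v z b :
  (bracket (u *: 'v_(BL 0) + v *: 'v_BC) z)@_b = u * - wt b * z@_b.
Proof.
rewrite bracketDl 2!bracketZl mcoeff_comb2.
have -> : bracket 'v_BC z = 0.
  by rewrite bracketEl linext_basis /linext big1 // => d _; case: d => *; rewrite scaler0.
rewrite mcoeff0 mulr0 addr0 -mulrA; congr (_ * _).
rewrite bracketEl linext_basis [X in _ * X@__](linE lin_id) /linext !raddf_sum mulr_sumr.
apply: eq_bigr => d _; rewrite br_L0 /= !mcoeffZ mcoeff_basis.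
by case: eqP => [->|_]; rewrite ?mulr1 ?mulr0 // mulrC.
Qed.

(** * Top-degree terms of brackets *)

Lemma sum_msupp1 (x : S) (G : SVB -> F) a :
  (forall b, b != a -> G b = 0) -> (x@_a = 0 -> G a = 0) ->
  \sum_(b <- finmap.enum_fset (msupp x)) G b = G a.
Proof.
move=> G0 Ga; have [xa|xa] := boolP (a \in msupp x).
  rewrite (big_fsetD1 a) //= big1_fset ?addr0 // => b.
  by rewrite in_fsetD1 => /andP[ba _] _; apply: G0.
rewrite Ga ?mcoeff_outdom //; apply: big1_fset => b xb _; apply: G0.
by apply: contraNneq xa => <-.
Qed.

(** Degrees at most [n] and [d] add up to [n + d] only for the pair of top terms. Evenness rules out
    brackets of two [BG] vectors, which also produce [BL] terms. *)
Lemma mcoeff_bracket_top y z (n d : int) : evenF y -> evenF z ->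
  (forall j, n < j -> y@_(BL j) = 0) -> (forall j, d < j -> z@_(BL j) = 0) ->
  (bracket y z)@_(BL (n + d)) = (n - d)%:~R * (y@_(BL n) * z@_(BL d)).
Proof.
move=> ey ez yn zd; rewrite mcoeff_bracket.
have br0 a b : (a, b) != (BL n, BL d) ->
    y@_a * z@_b * (br a b)@_(BL (n + d)) = 0.
  case: a b => [m|k|] [l|l|] nab /=; rewrite ?mcoeff0 ?mulr0 //;
    try by [rewrite ey // !mul0r | rewrite ez // mulr0 mul0r].
  have [/yn ->|mn] := ltP n m; first by rewrite !mul0r.
  have [/zd ->|ld] := ltP d l; first by rewrite mulr0 mul0r.
  rewrite mcoeff_comb2 !mcoeff_basis.
  have -> : (BL (m + l) == BL (n + d)) = false.
    by apply: contraNF nab => /eqP[e]; apply/eqP; congr (BL _, BL _); lia.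
  by rewrite !mulr0 addr0 mulr0.
rewrite (@sum_msupp1 _ _ (BL n)); first last.
- by move=> y0; rewrite big1 // => b _; rewrite y0 !mul0r.
- by move=> a an; rewrite big1 // => b _; apply: br0; apply: contraNneq an => -[->].
rewrite (@sum_msupp1 _ _ (BL d)); first last.
- by move=> z0; rewrite z0 mulr0 mul0r.
- by move=> b bd; apply: br0; apply: contraNneq bd => -[->].
by rewrite /= mcoeff_comb2 !mcoeff_basis eqxx mulr0 addr0 mulr1 mulrC.
Qed.

(** Raise [k] as long as a larger degree occurs. Finite support bounds the degrees by [N], and [p]
    bounds the number [N - k] of steps left. *)
Lemma top_degree (z : S) (k : int) : z@_(BL k) != 0 ->
  exists d, [/\ k <= d, z@_(BL d) != 0 & forall j, d < j -> z@_(BL j) = 0].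
Proof.
pose deg b := if b is BL j then absz j else 0%N.
pose N : nat := \max_(b <- finmap.enum_fset (msupp z)) deg b.
have zN j : z@_(BL j) != 0 -> j <= N%:Z.
  rewrite mcoeff_neq0 => zj; have : (deg (BL j) <= N)%N by apply: leq_bigmax_seq.
  by rewrite /=; lia.
have [p] : exists p : nat, N%:Z - k <= p%:Z by exists (absz (N%:Z - k)); lia.
elim: p k => [|p IHp] k pk zk.
  exists k; split=> // j kj; apply/eqP; apply: contraLR (kj) => /zN; lia.
have [/hasP[b _]|/hasPn nj] := boolP (has (fun b => (if b is BL j then k < j else false)
    && (z@_b != 0)) (finmap.enum_fset (msupp z))).
  case: b => // j /andP[kj zj]; have [||d [jd zd dmax]] := IHp j => //; first lia.
  by exists d; split=> //; lia.
exists k; split=> // j kj; apply/eqP; apply: contraT => zj.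
by have := nj (BL j); rewrite -mcoeff_neq0 kj zj => /(_ isT).
Qed.

Lemma mcoeff_exists (x : S) : x != 0 -> exists b, x@_b != 0.
Proof.
move=> x0; have [e|/fset0Pn[b]] := eqVneq (msupp x) fset0; last first.
  by rewrite -mcoeff_neq0; exists b.
case/eqP: x0; apply/malgP => b; rewrite mcoeff0 mcoeff_outdom //.
by rewrite e in_fset0.
Qed.

Lemma basis_neq0 b : 'v_b != 0.
Proof. by rewrite monalgU_eq0 oner_eq0. Qed.

Lemma autF_comp f g : autF f -> autF g -> autF (f \o g).
Proof.
move=> [lf bf pf mf] [lg bg pg mg]; split; first exact: lin_comp.
- exact: bij_comp.
- by move=> x; split=> [/(pg x).1 /(pf _).1|/(pg x).2 /(pf _).2].
- by move=> x y /=; rewrite mg mf.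
Qed.

Lemma even_basis b : ~~ odd_basis b -> evenF 'v_b.
Proof. by move=> eb d od; rewrite mcoeff_basis; case: eqP eb => // ->; rewrite od. Qed.

Lemma odd_basisF b : odd_basis b -> oddF 'v_b.
Proof. by move=> ob d; rewrite mcoeff_basis; case: eqP ob => // -> ->. Qed.

(** * The image of L_0 under an automorphism *)

Section Automorphism.

Context (f : S -> S) (aut_f : autF f).

Let lin_f : linear f. Proof. by case: aut_f. Qed.

Lemma aut_basis_neq0 b : f 'v_b != 0.
Proof.
case: aut_f => _ /bij_inj inj_f _ _; rewrite -(lin0 lin_f) (inj_eq inj_f).
exact: basis_neq0.
Qed.

Lemma aut_surj b : exists d, (f 'v_d)@_b != 0.
Proof.
case: aut_f => _ [g _ fK] _ _.
have := linE lin_f (g 'v_b); rewrite fK => e.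
have [/hasP[d _ ?]|/hasPn nd] := boolP (has (fun d => (f 'v_d)@_b != 0)
  (finmap.enum_fset (msupp (g 'v_b)))); first by exists d.
have /eqP := congr1 (mcoeff b) e.
rewrite mcoeff_basis eqxx raddf_sum big1_fset ?oner_eq0 // => d zd _ /=.
by rewrite mcoeffZ; have := nd d zd; rewrite negbK => /eqP ->; rewrite mulr0.
Qed.

Lemma aut_even b : ~~ odd_basis b -> evenF (f 'v_b).
Proof. by case: aut_f => _ _ pf _ /even_basis /(pf _).1. Qed.

Lemma aut_odd b : odd_basis b -> oddF (f 'v_b).
Proof. by case: aut_f => _ _ pf _ /odd_basisF /(pf _).2. Qed.

Lemma aut_parity b d : (f 'v_b)@_d != 0 -> odd_basis d = odd_basis b.
Proof.
have [ob|eb] := boolP (odd_basis b).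
  by apply: contraNeq => od; rewrite (aut_odd ob) //; case: odd_basis od.
by apply: contraNeq => od; rewrite (aut_even eb) //; case: odd_basis od.
Qed.

Lemma aut_eigen b : bracket (f 'v_(BL 0)) (f 'v_b) = (- wt b) *: f 'v_b.
Proof.
by case: aut_f => _ _ _ <-; rewrite bracket_basis br_L0 (linZ lin_f).
Qed.

(* If L_n, n > 0, is the top term of f L_0, then an even eigenvector of ad (f L_0)
   has top degree n, since the product of top terms must cancel; the eigenvectors
   f b would then not reach L_(n+1). *)
Lemma aut_L0_pos (n : int) : 0 < n -> (f 'v_(BL 0))@_(BL n) = 0.
Proof.
move=> n0; apply/eqP; apply: contraT => /top_degree[d0 [nd yd ymax]].
have small b k : d0 < k -> (f 'v_b)@_(BL k) = 0.
  move=> dk; apply/eqP; apply: contraT => zk.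
  have eb : ~~ odd_basis b by rewrite -(aut_parity zk).
  have [d [kd zd zmax]] := top_degree zk.
  have := mcoeff_bracket_top (aut_even (isT : ~~ odd_basis (BL 0))) (aut_even eb) ymax zmax.
  (* Since [0 < n <= d0], the degree [d0 + d] exceeds the top degree [d] of the eigenvector, whose
     coefficient there is zero. *)
  rewrite aut_eigen mcoeffZ zmax ?mulr0; last lia.
  move=> /esym/eqP; rewrite !mulf_eq0 (negbTE yd) (negbTE zd) !orbF intr_eq0.
  by lia.
by have [b] := aut_surj (BL (d0 + 1)); rewrite small ?eqxx //; lia.
Qed.

End Automorphism.

(** Odd terms are excluded by parity and positive degrees by [aut_L0_pos]; negative degrees become
    positive after composing with an automorphism that reverses the grading. *)
Lemma aut_L0 f : autF f -> exists u v, f 'v_(BL 0) = u *: 'v_(BL 0) + v *: 'v_BC.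
Proof.
move=> aut_f; exists ((f 'v_(BL 0))@_(BL 0)), ((f 'v_(BL 0))@_BC).
apply/malgP => b; rewrite mcoeff_comb2 !mcoeff_basis.
case: b => [m|k|]; last 1 first.
- by rewrite mulr0 add0r mulr1.
- have [->|m0] := eqVneq m 0; first by rewrite eqxx mulr1 mulr0 addr0.
  have -> : (BL 0 == BL m) = false by apply: contraNF m0 => /eqP[<-].
  rewrite !mulr0 addr0; have [m_gt0|m_le0] := ltP 0 m; first exact: aut_L0_pos.
  (* For [s = true] and [a = 1] the condition on [c] reads [c ^+ 2 = -1]. *)
  have aut_g : autF (svaut true 1 'i).
    by apply: autF_svaut; rewrite ?oner_eq0 // sqrCi expr1 exp1rz mulr1.
  have nm : 0 < - m by lia.
  have := aut_L0_pos (autF_comp aut_g aut_f) nm.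
  rewrite (_ : BL (- m) = flip true (BL m)) // mcoeff_svaut => /eqP.
  by rewrite mulf_eq0 (negbTE (svweight_neq0 _ _ _ _)) ?oner_eq0 ?neq0Ci // => /eqP.
- by rewrite (aut_even aut_f (isT : ~~ odd_basis (BL 0)) (isT : odd_basis (BG k))) /= !mulr0 addr0.
Qed.

(** * Automorphisms are monomial in the basis *)

Section MonomialForm.

Context (f : S -> S) (aut_f : autF f).

Let lin_f : linear f. Proof. by case: aut_f. Qed.

(** Let [u] be the [BL 0] coefficient of [f 'v_(BL 0)]. It is an integer because [BL 1] occurs in
    the image of some basis vector, and it divides 1 because the image of [BL 1] is nonzero; hence
    it is a sign. *)
Lemma aut_sign : exists (s : bool) (v : F),
  f 'v_(BL 0) = (-1) ^+ s *: 'v_(BL 0) + v *: 'v_BC /\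
  forall b d, (f 'v_b)@_d != 0 -> wt d = wt (flip s b).
Proof.
have [u [v yE]] := aut_L0 aut_f.
have wtE b d : (f 'v_b)@_d != 0 -> u * wt d = wt b.
  have := congr1 (mcoeff d) (aut_eigen aut_f b).
  rewrite yE mcoeff_bracket_L0C mcoeffZ mulrN => e nz.
  by apply/oppr_inj/(mulIf nz).
have wtZ b : ~~ odd_basis b -> exists m : int, wt b = m%:~R.
  by case: b => [m|k|] // _; [exists m | exists 0].
have [s us] : exists s : bool, u = (-1) ^+ s.
  have [b nz] := aut_surj aut_f (BL 1).
  have [|m bm] := wtZ b; first by rewrite -(aut_parity aut_f nz).
  have [d nz'] := mcoeff_exists (aut_basis_neq0 aut_f (BL 1)).
  have [|n dn] := wtZ d; first by rewrite (aut_parity aut_f nz').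
  have um := wtE _ _ nz; rewrite /= mulr1 bm in um.
  have := wtE _ _ nz'; rewrite dn um /= -intrM => /intr_inj mn.
  have /orP[] : (m == 1) || (m == -1) := intUnitRing.unitzPl (etrans (mulrC n m) mn).
    by move=> /eqP m1; exists false; rewrite m1 expr0.
  by move=> /eqP m1; exists true; rewrite m1 expr1.
exists s, v; split=> [|b d /wtE]; first by rewrite -us.
by rewrite wt_flip us => <-; rewrite mulrA -expr2 sqrr_sign mul1r.
Qed.

(** Weight and parity single out one basis vector, except in the span of [BL 0] and [BC]. That plane
    is settled by the centrality of [BC] and by the brackets of [BL m] with [BL (- m)] for
    [m = 1, 2]. *)
Lemma aut_monomial : exists (s : bool) (w : SVB -> F),
  [/\ forall b, f 'v_b = w b *: 'v_(flip s b), w (BL 0) = (-1) ^+ s & w BC = (-1) ^+ s].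
Proof.
have [s [v [yE wtE]]] := aut_sign.
pose w b := (f 'v_b)@_(flip s b).
have good b : odd_basis b || (wt b != 0) -> f 'v_b = w b *: 'v_(flip s b).
  move=> gb; apply/malgP => d; rewrite mcoeffZ mcoeff_basis.
  have [->|fd] := eqVneq d (flip s b); first by rewrite mulr1.
  rewrite mulr0; apply/eqP; apply: contraNT fd => nz.
  apply/eqP/wt_inj; rewrite ?(wtE _ _ nz) ?(aut_parity aut_f nz) ?odd_flip //.
  by rewrite wt_flip mulf_eq0 signr_eq0.
have goodL m : m != 0 -> f 'v_(BL m) = w (BL m) *: 'v_(flip s (BL m)).
  by move=> m0; apply: good; rewrite /= intr_eq0.
have mf x y : f (bracket x y) = bracket (f x) (f y) by case: aut_f.
have s2 : (-1) ^+ s * (-1) ^+ s = 1 :> F by rewrite -expr2 sqrr_sign.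
have w_neq0 b : odd_basis b || (wt b != 0) -> w b != 0.
  move=> gb; have := aut_basis_neq0 aut_f b.
  by rewrite good //; apply: contraNneq => ->; rewrite scale0r.
have fCE : f 'v_BC = (f 'v_BC)@_(BL 0) *: 'v_(BL 0) + (f 'v_BC)@_BC *: 'v_BC.
  apply/malgP => d; rewrite mcoeff_comb2 !mcoeff_basis.
  have [->|dL] := eqVneq d (BL 0); first by rewrite mulr1 mulr0 addr0.
  have [->|dC] := eqVneq d BC; first by rewrite mulr1 mulr0 add0r.
  rewrite !mulr0 addr0.
  apply/eqP; apply: contraT => nz; have := aut_parity aut_f nz.
  have := wtE _ _ nz; case: d dL dC {nz} => // m dL _ /= /eqP.
  by rewrite intr_eq0 => /eqP m0; rewrite m0 eqxx in dL.
(* The image of [BC] commutes with that of [BL 1], on which a [BL 0] component would act by a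
   nonzero weight. *)
have fC0 : (f 'v_BC)@_(BL 0) = 0.
  have w1 : w (BL 1) != 0 by apply: w_neq0; rewrite /= oner_eq0.
  have f1 : wt (flip s (BL 1)) != 0.
    by rewrite wt_flip mulf_neq0 ?signr_eq0 ?oner_eq0.
  have := congr1 (mcoeff (flip s (BL 1))) (mf 'v_BC 'v_(BL 1)).
  rewrite bracket_basis [br _ _]/= (lin0 lin_f) mcoeff0 fCE mcoeff_bracket_L0C -fCE.
  rewrite -/(w _) => /esym/eqP.
  by rewrite !mulf_eq0 oppr_eq0 (negbTE w1) (negbTE f1) !orbF => /eqP.
have flip0 : flip s (BL 0) = BL 0 by rewrite /= oppr0 if_same.
have brN m : br (BL m) (BL (- m)) =
    (2 * m%:~R) *: 'v_(BL 0) + ((m%:~R ^+ 3 - m%:~R) / 12%:R) *: 'v_BC.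
  rewrite /= subrr eqxx mul1r; apply: eq_comb2; first by rewrite opprK rmorphD /=; ring.
  by rewrite rmorphB rmorphXn.
have rel m : m != 0 ->
    (2 * m%:~R) *: f 'v_(BL 0) + ((m%:~R ^+ 3 - m%:~R) / 12%:R) *: f 'v_BC =
    (w (BL m) * w (BL (- m)) * (-1) ^+ s) *: br (BL m) (BL (- m)).
  move=> m0; rewrite -!(linZ lin_f) -(linD lin_f) -brN -bracket_basis mf.
  rewrite !goodL ?oppr_eq0 // bracketZZ !bracket_basis -[RHS]scalerA; congr (_ *: _).
  case: (s); last by rewrite expr0 scale1r.
  rewrite /= expr1 scaleN1r !opprK addNr addrN eqxx opprD -!scaleNr; apply: eq_comb2.
    by rewrite -rmorphN /=; congr (_%:~R); lia.
  by rewrite !mul1r -mulNr -rmorphN /=; congr (_%:~R / _); ring.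
have relC m : m != 0 -> 2 * m%:~R * v + ((m%:~R ^+ 3 - m%:~R) / 12%:R) * (f 'v_BC)@_BC
    = (-1) ^+ s * ((m%:~R ^+ 3 - m%:~R) / 12%:R).
  move=> m0; have mF : m%:~R != 0 :> F by rewrite intr_eq0.
  have e0 := congr1 (mcoeff (BL 0)) (rel m m0).
  have := congr1 (mcoeff BC) (rel m m0).
  move: e0; rewrite yE brN !mcoeff_comb2 (mcoeffZ _ _ (BL 0)) (mcoeffZ _ _ BC) !mcoeff_comb2.
  rewrite fC0 !mcoeff_basis !eqxx !mulr0 !addr0 !add0r !mulr1.
  (* The [BL 0] coefficients give [ww = 1], which removes the unknown weights from the equation at
     [BC]. *)
  set ww := w _ * w _ => e0; have -> : ww = 1.
    have n0 : (-1) ^+ s * (2 * m%:~R) != 0 :> F.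
      by rewrite !mulf_neq0 ?signr_eq0 ?pnatr_eq0.
    by apply: (mulIf n0); rewrite mul1r mulrA -e0 mulrC.
  by rewrite mul1r.
(* At [m = 1] the cubic [m ^+ 3 - m] vanishes, leaving [2 v = 0]. *)
have v0 : v = 0.
  have /eqP := relC 1 isT; rewrite expr1n subrr !mul0r mulr0 addr0 mulf_eq0.
  by rewrite mulf_eq0 pnatr_eq0 oner_eq0 => /eqP.
(* At [m = 2] the cubic equals 6, so the central coefficient can be cancelled. *)
have cC : (f 'v_BC)@_BC = (-1) ^+ s.
  have := relC 2 isT; rewrite v0 mulr0 add0r [RHS]mulrC; apply: mulfI.
  have -> : 2%:~R ^+ 3 - 2%:~R = 6%:R :> F by ring.
  by rewrite mulf_neq0 ?invr_eq0 ?pnatr_eq0.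
have wL0 : w (BL 0) = (-1) ^+ s.
  by rewrite /w flip0 yE mcoeff_comb2 !mcoeff_basis eqxx mulr0 addr0 mulr1.
exists s, w; split=> // b; have [/good //|] := boolP (odd_basis b || (wt b != 0)).
case: b => [m|k|] //=.
  rewrite negbK intr_eq0 => /eqP ->; rewrite wL0 yE v0 scale0r addr0.
  by rewrite oppr0 if_same.
by move=> _; rewrite fCE fC0 scale0r add0r.
Qed.
End MonomialForm.

(** * Classification of automorphisms *)

(* The relation [L_m, L_n] = (m - n) L_(m + n) + ... gives no information for m = n. *)
Lemma quasi_exp (psi : int -> F) : psi 0 = 1 ->
  (forall m n, m != n -> psi (m + n) = psi m * psi n) ->
  psi 1 != 0 /\ forall m, psi m = psi 1 ^ m.
Proof.
move=> p0 pD; have pN m : m != 0 -> psi (- m) * psi m = 1.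
  by move=> m0; rewrite -pD ?addNr //; lia.
have p1 : psi 1 != 0.
  by apply/eqP => e; have := pN 1 isT; rewrite e mulr0 => /esym/eqP; rewrite oner_eq0.
(* The sum [1 + 1] is not allowed, so [psi 2] is obtained from [2 + -1 = 1] and the inverse
   [psi (-1)] of [psi 1]. *)
have p2 : psi 2 = psi 1 ^+ 2.
  have e : psi 1 = psi 2 * psi (-1) by rewrite -pD.
  by rewrite -[LHS]mulr1 -(pN 1 isT) mulrA -e expr2.
have pn (n : nat) : psi n%:Z = psi 1 ^+ n.
  elim: n => [|[|[|n]] IHn] //.
  by rewrite exprSr -IHn -pD; [congr psi; lia | lia].
split=> // -[n|n]; first exact: pn.
rewrite NegzE -exprnN; apply: (mulIf (expf_neq0 n.+1 p1)).
by rewrite mulVf ?expf_neq0 // -pn pN.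
Qed.

(** Dividing the weights of [f] by the weights [w1] of the known automorphism [svaut s 1 c0] cancels
    the structure constants: the quotient [u] satisfies [u e = u b * u d] whenever [e] occurs in the
    bracket of [b] and [d]. *)
Lemma aut_classify f : autF f -> exists (s : bool) (a c : F),
  [/\ a != 0, c ^+ 2 = (-1) ^+ s * a ^ epsZ ns & f =1 svaut s a c].
Proof.
move=> aut_f; have [lf _ _ mf] := aut_f.
have [s [w [fE wL0 wC]]] := aut_monomial aut_f.
pose c0 : F := if s then 'i else 1.
have c02 : c0 ^+ 2 = (-1) ^+ s.
  by rewrite /c0; case: (s); rewrite ?sqrCi ?expr1n ?expr0 ?expr1.
have c00 : c0 != 0 by rewrite -sqrf_eq0 c02 signr_eq0.
pose w1 := svweight s 1 c0.
have w1_neq0 b : w1 b != 0 by apply: svweight_neq0; rewrite ?oner_eq0.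
pose u b := w b / w1 b.
have uD b d e : (br b d)@_e != 0 -> u e = u b * u d.
  move=> X0.
  have r : w e * (br b d)@_e = w b * w d * (br (flip s b) (flip s d))@_(flip s e).
    rewrite -(mcoeff_monomial lf fE) -!bracket_basis mf !fE bracketZZ.
    by rewrite mcoeffZ.
  have r1 : w1 e * (br b d)@_e = w1 b * w1 d * (br (flip s b) (flip s d))@_(flip s e).
    by rewrite -mcoeff_svaut svaut_br ?oner_eq0 ?exp1rz ?mulr1 // mcoeffZ.
  apply: (mulIf X0); apply: (mulfI (w1_neq0 e)); rewrite /u.
  rewrite [RHS]mulrCA r1 mulrA [w1 e * _]mulrC divfK // r.
  by field; rewrite !w1_neq0.
have [p1 pE] : u (BL 1) != 0 /\ forall m, u (BL m) = u (BL 1) ^ m.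
  apply: (@quasi_exp (fun m => u (BL m))).
    by rewrite /u wL0 /w1 /= expr0z mulr1 divff ?signr_eq0.
  move=> m n mn; apply: uD; rewrite /= mcoeff_comb2 !mcoeff_basis eqxx mulr0 addr0 mulr1.
  by rewrite intr_eq0 subr_eq0.
have gD (m k : int) : m != 2 * k + epsZ ns -> u (BG (m + k)) = u (BL 1) ^ m * u (BG k).
  move=> mk; rewrite -pE; apply: uD; rewrite /= mcoeffZ mcoeff_basis eqxx mulr1.
  have -> : m%:~R / 2 - idx k = (m - (2 * k + epsZ ns))%:~R / 2 :> F.
    rewrite !rmorphB rmorphD rmorphM /= /idx /epsZ.
    by case: ns => /=; field.
  by rewrite mulf_neq0 ?invr_eq0 ?pnatr_eq0 // intr_eq0 subr_eq0.
(* The bracket of [BL m] with [BG 0] vanishes for [m = epsZ ns]. For eps = 0 this is the trivial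
   case [m = 0]; for eps = 1/2 it is [m = 1], and [BG 1] is reached from [BG 0] through
   [BG (-1)]. *)
have gE m : u (BG m) = u (BL 1) ^ m * u (BG 0).
  have [m0|m0] := eqVneq m (epsZ ns); last first.
    by rewrite -[in LHS](addr0 m) gD // mulr0 add0r.
  rewrite m0 /epsZ; move: gD; rewrite /epsZ; case: ns => gD; last by rewrite expr0z mul1r.
  rewrite -[in LHS](_ : 2 + -1 = 1) // gD // -[in BG (-1)](addr0 (-1)) gD // mulrA.
  by rewrite -expfzDr.
exists s, (u (BL 1)), (c0 * u (BG 0)); split=> //.
  (* The square of [u (BG 0)] is read off the bracket of [BG 0] with itself, whose coefficient at
     [BL (epsZ ns)] is 2. *)
  rewrite exprMn c02 -pE; congr (_ * _); rewrite expr2; apply/esym.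
  apply: uD; rewrite /= !add0r mcoeff_comb2 !mcoeff_basis eqxx mulr0 addr0 mulr1.
  by rewrite pnatr_eq0.
apply: (eq_lin_basis lf (@svaut_lin s _ _)) => b; rewrite fE svaut_basis; congr (_ *: _).
have -> : w b = w1 b * u b by rewrite mulrC divfK.
case: b => [m|k|]; rewrite /w1 /=.
- by rewrite pE exp1rz mulr1.
- by rewrite gE exp1rz mulr1 [RHS]mulrAC mulrA.
- by rewrite /u wC /w1 /= mulrC divfK ?signr_eq0.
Qed.

(** * Local automorphisms *)

Lemma autF_ext f g : f =1 g -> autF g -> autF f.
Proof.
move=> fg [lg bg pg mg]; split.
- by move=> c x y; rewrite !fg lg.
- by apply: (eq_bij bg) => x; rewrite fg.
- by move=> x; rewrite !fg; exact: pg.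
- by move=> x y; rewrite !fg mg.
Qed.

Lemma local_autF_autF (phi : S -> S) : linear phi ->
  (forall x, exists theta, autF theta /\ phi x = theta x) -> autF phi.
Proof.
move=> lphi loc.
have {}loc x : exists (s : bool) (a c : F),
    [/\ a != 0, c ^+ 2 = (-1) ^+ s * a ^ epsZ ns & phi x = svaut s a c x].
  have [theta [/aut_classify[s [a [c [a0 c2 e]]]] ->]] := loc x.
  by exists s, a, c; split.
have flip0 s : flip s (BL 0) = BL 0 by rewrite /= oppr0 if_same.
have [s [a0 [c0 [_ _ phi0]]]] := loc 'v_(BL 0).
have {a0 c0 phi0} phiL0 : phi 'v_(BL 0) = ((-1) ^+ s : F) *: 'v_(BL 0).
  by rewrite phi0 svaut_basis flip0 /= expr0z mulr1.
have sign_inj (s1 s2 : bool) : (-1) ^+ s1 = (-1) ^+ s2 :> F -> s1 = s2.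
  by move=> /eqP; rewrite (inj_eq (@signr_inj _)) => /eqP.
have [om phiE] : exists om : SVB -> F, forall b, phi 'v_b = om b *: 'v_(flip s b).
  exists (fun b => (phi 'v_b)@_(flip s b)) => b.
  suff [t ->] : exists t, phi 'v_b = t *: 'v_(flip s b).
    by rewrite mcoeffZ mcoeff_basis eqxx mulr1.
  have [->|b0] := eqVneq b (BL 0); first by rewrite flip0; exists ((-1) ^+ s).
  (* The value at ['v_b] has no [BL 0] term, so the [BL 0] coefficient at the sum forces [s2 = s].
     Cancelling the image of [BL 0] then leaves a multiple of ['v_(flip s b)]. *)
  have [s1 [a1 [c1 [_ _ phi1]]]] := loc 'v_b.
  have [s2 [a2 [c2 [_ _ phi2]]]] := loc ('v_(BL 0) + 'v_b).
  have L2 : svaut s2 a2 c2 'v_(BL 0) = ((-1) ^+ s2 : F) *: 'v_(BL 0).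
    by rewrite svaut_basis flip0 /= expr0z mulr1.
  have nb s' : (flip s' b == BL 0) = false.
    by rewrite -[X in _ == X](flip0 s') (inj_eq (can_inj (flipK s'))) (negbTE b0).
  move: phi2; rewrite (linD lphi) (linD (@svaut_lin s2 a2 c2)) L2 phiL0 phi1 => e.
  have ss : s = s2.
    apply: sign_inj; have := congr1 (mcoeff (BL 0)) e.
    by rewrite !(svaut_basis, mcoeffD, mcoeffZ, mcoeff_basis) !nb eqxx !mulr0 !addr0 !mulr1.
  by move: e; rewrite -ss => /addrI ->; rewrite svaut_basis; eexists.
have phi_coef x b : (phi x)@_(flip s b) = om b * x@_b by exact: mcoeff_monomial.
have om0 : om (BL 0) = (-1) ^+ s.
  have := congr1 (mcoeff (BL 0)) (phiE (BL 0)); rewrite phiL0 flip0 !mcoeffZ mcoeff_basis eqxx.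
  by rewrite !mulr1.
(* A nonzero [BL 0] coefficient forces the sign [s], and one pair [a], [c] then gives [om] on the
   whole support of [x]. *)
have om_val (x : S) : x@_(BL 0) != 0 -> exists a c : F,
    [/\ a != 0, c ^+ 2 = (-1) ^+ s * a ^ epsZ ns &
     forall b, x@_b != 0 -> om b = svweight s a c b].
  move=> x0; have [s2 [a [c [a0 c2 e]]]] := loc x.
  have ss : s = s2.
    apply/sign_inj/(mulIf x0); rewrite -om0 -phi_coef e flip0 -(flip0 s2) mcoeff_svaut.
    by rewrite flip0 /= expr0z mulr1.
  subst s2; exists a, c; split=> // b xb; apply: (mulIf xb).
  by rewrite -phi_coef e mcoeff_svaut.
pose x0 := 'v_(BL 0) + 'v_(BL 1) + 'v_(BG 0).
have x0E d : x0@_d = ((BL 0 == d) + (BL 1 == d) + (BG 0 == d))%:R.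
  by rewrite 2!mcoeffD !mcoeff_basis !natrD.
have x0L0 : x0@_(BL 0) = 1 by rewrite x0E.
have x0L1 : x0@_(BL 1) = 1 by rewrite x0E.
have x0G0 : x0@_(BG 0) = 1 by rewrite x0E.
have [|a [c [a0 c2 omx]]] := om_val x0; first by rewrite x0L0 oner_eq0.
apply: (@autF_ext _ (svaut s a c)) (autF_svaut a0 c2).
apply: (eq_lin_basis lphi (@svaut_lin s a c)) => b.
rewrite phiE svaut_basis; congr (_ *: _).
(* If [b] already occurs in [x0], its coefficient in [x0 + 'v_b] is 2, still nonzero. *)
have nz (t : nat) : 1 + t%:R != 0 :> F by rewrite -[1]/(1%:R) -natrD pnatr_eq0.
have [|a' [c' [_ _ omb]]] := om_val (x0 + 'v_b).
  by rewrite mcoeffD x0L0 mcoeff_basis nz.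
have aa : a = a'.
  have := omb (BL 1); rewrite mcoeffD x0L1 mcoeff_basis nz omx ?x0L1 ?oner_eq0 // => /(_ isT).
  by rewrite /= !expr1z => /mulfI -> //; rewrite signr_eq0.
have cc : c = c'.
  have := omb (BG 0); rewrite mcoeffD x0G0 mcoeff_basis nz omx ?x0G0 ?oner_eq0 // => /(_ isT).
  by rewrite /= !expr0z !mulr1.
by rewrite omb -?aa -?cc // mcoeffD x0E mcoeff_basis eqxx -natrD pnatr_eq0 addn1.
Qed.

End SuperVirasoro.

(* ns = false : eps = 0 ;  ns = true : eps = 1/2 *)
Theorem theorem5p3 (ns : bool) (phi : SV -> SV) :
  is_local_automorphism ns phi -> is_automorphism ns phi.
Proof. by move=> [lphi loc]; exact: (@local_autF_autF CC ns phi lphi loc). Qed.
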